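(* Let $G$ be a connected graph of order $n\ge 2$. Then $G$ is $\mathfrak{d}(G)$-partition dimensional, and the time complexity of computing $\mathfrak{d}(G)$ is $O(n^3)$.
   Context: All graphs $G=(V,E)$ are finite, simple, connected and have at least two vertices; $d(x,y)$ denotes the length of a shortest path between $x$ and $y$ in $G$. For $a\in V$ and nonempty $S\subseteq V$, $d(a,S)=\min_{v\in S} d(a,v)$. A nonempty set $S\subseteq V$ distinguishes two different vertices $x,y\in V$ if $d(x,S)\neq d(y,S)$. For a positive integer $k$, a partition $\Pi$ of $V$ (into nonempty sets) is a $k$-partition generator of $G$ if every pair of different vertices of $G$ is distinguished by at least $k$ of the sets of $\Pi$. A $k$-partition basis of $G$ is a $k$-partition generator of minimum cardinality among all $k$-partition generators of $G$. The graph $G$ is $k$-partition dimensional if $k$ is the largest integer such that there exists a $k$-partition basis of $G$. For different $x,y\in V$, $\mathcal{D}_G(x,y)=\{z\in V: d(z,x)\neq d(z,y)\}$, and $\mathfrak{d}(G)=\min_{x,y\in V,\,x\neq y}|\mathcal{D}_G(x,y)|$. *)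

(* Defs.v *)
From HB Require Import structures.
From mathcomp Require Import all_boot.

Set Implicit Arguments.
Unset Strict Implicit.
Unset Printing Implicit Defensive.

Record sgraph := SGraph {
  vertex :> finType;
  adj : rel vertex;
  adj_sym : symmetric adj;
  adj_irrefl : irreflexive adj }.

Section Graph.
Variable G : sgraph.
Implicit Types (x y z : G) (S : {set G}) (P : {set {set G}}) (k : nat).

Definition connected_graph := forall x y, connect (@adj G) x y.

Definition has_path x y k :=
  [exists p : k.-tuple G,
    [&& path (@adj G) x p, uniq (x :: p) & last x p == y]].

(* A path has fewer than #|G| edges, so in a connected graph the default value
   #|G| of the minimum is never attained; the same default is harmless in
   [setdist] for nonempty S and in [frakd] as soon as there are two vertices. *)
Definition dist x y := \big[minn/#|G|]_(k < #|G| | has_path x y k) k.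

Definition setdist x S := \big[minn/#|G|]_(v in S) dist x v.

Definition distinguishes S x y := setdist x S != setdist y S.

(* [partition] requires the blocks to be nonempty. *)
Definition partition_generator k P :=
  partition P [set: G] /\
  forall x y, x != y -> k <= #|[set S in P | distinguishes S x y]|.

Definition partition_basis k P :=
  partition_generator k P /\
  forall Q : {set {set G}}, partition_generator k Q -> #|P| <= #|Q|.

Definition partition_dimensional k :=
  [/\ 0 < k,
      exists P, partition_basis k P
    & forall l, 0 < l -> (exists P, partition_basis l P) -> l <= k].

Definition distinctive x y : {set G} := [set z | dist z x != dist z y].

Definition frakd :=
  \big[minn/#|G|]_(q : G * G | q.1 != q.2) #|distinctive q.1 q.2|.

End Graph.

(* Running times are measured on a unit-cost random access machine with
   words of logarithmic length: structured programs act on registers and on an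
   indirectly addressed memory, and a computation is stuck as soon as an
   expression takes a value outside [0, w[.  The bound w is polynomial in the
   order of the input graph (see [computable_in_time]), so that no operation
   charged one unit handles more than O(log n) bits. *)
Inductive binop := OpAdd | OpSub | OpMul | OpLt | OpEq.

Inductive expr :=
| Const of nat
| Reg of nat
| Read of expr
| Bin of binop & expr & expr.

Inductive prog :=
| Skip
| Assign of nat & expr
| Write of expr & expr
| Seq of prog & prog
| If of expr & prog & prog
| While of expr & prog.

Record state := State { regs : nat -> nat; cells : nat -> nat }.

Definition upd (f : nat -> nat) a v := fun b => if b == a then v else f b.

Definition set_reg s r v := State (upd (regs s) r v) (cells s).
Definition set_mem s a v := State (regs s) (upd (cells s) a v).

Definition word w v := if v < w then Some v else None.

Definition binop_sem o (a b : nat) : nat :=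
  match o with
  | OpAdd => a + b
  | OpSub => a - b
  | OpMul => a * b
  | OpLt => a < b
  | OpEq => a == b
  end.

Fixpoint eval w s e : option nat :=
  match e with
  | Const c => word w c
  | Reg r => word w (regs s r)
  | Read e1 => obind (fun a => word w (cells s a)) (eval w s e1)
  | Bin o e1 e2 =>
      obind (fun a => obind (fun b => word w (binop_sem o a b)) (eval w s e2))
            (eval w s e1)
  end.

Fixpoint cost e : nat :=
  match e with
  | Const _ | Reg _ => 1
  | Read e1 => (cost e1).+1
  | Bin _ e1 e2 => (cost e1 + cost e2).+1
  end.

(* [exec w p s t s']: with word bound w, the program p started in s halts in s'
   after t units of time. *)
Inductive exec w : prog -> state -> nat -> state -> Prop :=
| exec_skip s : exec w Skip s 1 s
| exec_assign r e v s :
    eval w s e = Some v ->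
    exec w (Assign r e) s (cost e).+1 (set_reg s r v)
| exec_write e1 e2 a v s :
    eval w s e1 = Some a -> eval w s e2 = Some v ->
    exec w (Write e1 e2) s (cost e1 + cost e2).+1 (set_mem s a v)
| exec_seq p1 p2 s s1 s2 t1 t2 :
    exec w p1 s t1 s1 -> exec w p2 s1 t2 s2 ->
    exec w (Seq p1 p2) s (t1 + t2) s2
| exec_if e v p1 p2 s s1 t :
    eval w s e = Some v ->
    exec w (if v != 0 then p1 else p2) s t s1 ->
    exec w (If e p1 p2) s ((cost e).+1 + t) s1
| exec_while_end e p s :
    eval w s e = Some 0 ->
    exec w (While e p) s (cost e).+1 s
| exec_while_loop e v p s s1 s2 t1 t2 :
    eval w s e = Some v -> v != 0 ->
    exec w p s t1 s1 -> exec w (While e p) s1 t2 s2 ->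
    exec w (While e p) s ((cost e).+1 + (t1 + t2)) s2.

(* The input is the order n of G, in register 0, and the adjacency matrix of G,
   row by row in the cells 0, ..., n * n - 1, for the numbering f of the
   vertices; everything else is initially zero. *)
Definition input_state (G : sgraph) (f : G -> 'I_#|G|) (s : state) :=
  [/\ regs s 0 = #|G|,
      forall r, 0 < r -> regs s r = 0,
      forall x y : G, cells s (f x * #|G| + f y) = adj x y :> nat
    & forall a, #|G| * #|G| <= a -> cells s a = 0].

(* One program, with time constant C and words of c * log2 n bits, must work
   for all graphs in the class K and all numberings of their vertices. *)
Definition computable_in_time (K : sgraph -> Prop) (F : sgraph -> nat)
    (T : nat -> nat) :=
  exists (p : prog) (c C : nat),
  forall G : sgraph, K G ->
  forall (f : G -> 'I_#|G|) (s : state), injective f -> input_state f s ->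
  exists (t : nat) (s' : state),
    [/\ exec (#|G| ^ c) p s t s', regs s' 0 = F G & t <= C * T #|G|].

(* Main.v *)
(* The partition into singletons distinguishes x and y by exactly the sets {z}
   with z in D(x, y), so it is a frakd(G)-partition generator.  Conversely, every
   set distinguishing x and y contains an element of D(x, y), and the sets of a
   partition are disjoint, so at most |D(x, y)| of them distinguish x and y.
   For the complexity, the Floyd-Warshall algorithm replaces the adjacency matrix
   in place by the distance matrix, after which three nested loops compute all
   the |D(x, y)| and their minimum. *)

Require Import Defs.
From HB Require Import structures.
From mathcomp Require Import all_boot.
From mathcomp Require Import zify.

Set Implicit Arguments.
Unset Strict Implicit.
Unset Printing Implicit Defensive.

(** * Minima over finite families with a default value *)

Section BigMin.
Variables (I : finType) (P : pred I) (F : I -> nat) (m : nat).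

Lemma bigmin_le_default : \big[minn/m]_(i | P i) F i <= m.
Proof.
elim/big_rec: _ => // i a _ le_am; exact: leq_trans (geq_minr _ _) le_am.
Qed.

Lemma bigmin_le i : P i -> \big[minn/m]_(j | P j) F j <= F i.
Proof.
move=> Pi; have: i \in index_enum I by rewrite mem_index_enum.
elim: (index_enum I) => // j r IHr; rewrite inE big_cons => /orP[/eqP <-|ir].
  by rewrite Pi geq_minl.
case: (P j); last exact: IHr.
exact: leq_trans (geq_minr _ _) (IHr ir).
Qed.

Lemma le_bigmin a :
  a <= m -> (forall i, P i -> a <= F i) -> a <= \big[minn/m]_(i | P i) F i.
Proof.
by move=> am aF; elim/big_rec: _ => // i b Pi ab; rewrite leq_min aF.
Qed.

Lemma bigmin_attained : \big[minn/m]_(i | P i) F i = m \/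
  exists2 i, P i & \big[minn/m]_(j | P j) F j = F i.
Proof.
elim/big_rec: _ => [|i a Pi IH]; first by left.
by case: leqP => _; [right; exists i | exact: IH].
Qed.

End BigMin.

(** * Metric properties of the graph distance *)

Section Distance.
Variable G : sgraph.
Implicit Types (x y z : G) (p : seq G) (S : {set G}) (P : {set {set G}}).

Lemma dist_le_order x y : dist x y <= #|G|.
Proof. exact: bigmin_le_default. Qed.

(** A walk shortens to a path without repeated vertices; such a path has fewer than [#|G|] edges, so
    its length is among the indices of the minimum defining [dist]. *)
Lemma dist_le_path x y p :
  path (@adj G) x p -> last x p = y -> dist x y <= size p.
Proof.
move=> xp; case: (shortenP xp) => q xq uq sub_qp <-{xp}.
have uq' := uq; rewrite cons_uniq in uq'; case/andP: uq' => _ uq'.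
apply: (@leq_trans (size q)); last exact: uniq_leq_size.
have lt_q : size q < #|G|.
  by have/card_uniqP sz := uq; rewrite -[_.+1]sz max_card.
apply: (@bigmin_le _ _ (fun k : 'I_#|G| => nat_of_ord k) _ (Ordinal lt_q)).
by apply/existsP; exists (in_tuple q); rewrite /= xq eqxx andbT -cons_uniq.
Qed.

(** The first alternative is the default value, taken when no path joins the two vertices. *)
Lemma dist_attained x y : dist x y = #|G| \/
  exists p, [/\ path (@adj G) x p, uniq (x :: p), last x p = y
              & size p = dist x y].
Proof.
rewrite /dist.
have [->|[k hk ->]] := @bigmin_attained 'I_#|G| (fun k => has_path x y k)
  (@nat_of_ord #|G|) #|G|.
  by left.
right; case/existsP: hk => p /and3P[xp up /eqP lp].
by exists p; split=> //; exact: size_tuple.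
Qed.

Lemma distxx x : dist x x = 0.
Proof. by apply/eqP; rewrite -leqn0 (@dist_le_path x x [::]). Qed.

Lemma dist_eq0 x y : (dist x y == 0) = (x == y).
Proof.
apply/eqP/eqP => [d0|->]; last exact: distxx.
case: (dist_attained x y) => [dG|[p [_ _ lp]]].
  by have := fintype0 x; rewrite -dG d0 => /(_ erefl).
by rewrite d0 => /size0nil p0; rewrite p0 in lp.
Qed.

Lemma dist_le_sym x y : dist x y <= dist y x.
Proof.
case: (dist_attained y x) => [->|[p [yp _ lp sp]]]; first exact: dist_le_order.
(* The walk back from [x] to [y] visits [rev (belast y p)] after its start [x]. *)
rewrite -sp -(size_belast y p) -size_rev -lp; apply: dist_le_path.
  by rewrite -rev_path in yp; rewrite (eq_path (@adj_sym G)) .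
by case: p {yp lp sp} => //= z p; rewrite rev_cons last_rcons.
Qed.

Lemma dist_sym x y : dist x y = dist y x.
Proof. by apply/eqP; rewrite eqn_leq !dist_le_sym. Qed.

Lemma dist_triangle x y z : dist x z <= dist x y + dist y z.
Proof.
case: (dist_attained x y) => [->|[p [xp _ lp <-]]].
  by rewrite (leq_trans (dist_le_order x z)) ?leq_addr.
case: (dist_attained y z) => [->|[q [yq _ lq <-]]].
  by rewrite (leq_trans (dist_le_order x z)) ?leq_addl.
by rewrite -size_cat; apply: dist_le_path; rewrite ?cat_path ?last_cat ?lp ?xp.
Qed.

(** * Distinguishing sets and the partition dimension *)

Lemma setdist1 x z : setdist x [set z] = dist x z.
Proof.
by rewrite /setdist big_set1E; apply/minn_idPl; exact: dist_le_order.
Qed.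

(** If no element of [S] lay in [distinctive x y], the minima [setdist x S] and [setdist y S] would
    agree term by term. *)
Lemma distinguishesP S x y :
  distinguishes S x y -> exists2 z, z \in S & z \in distinctive x y.
Proof.
move=> dS; apply/exists_inP; apply: contraT; rewrite negb_exists_in.
move/forall_inP => eqS; case/negP: dS; apply/eqP; apply: eq_bigr => z zS.
by have := eqS z zS; rewrite inE negbK dist_sym [dist z y]dist_sym => /eqP.
Qed.

Lemma card_distinguishing P x y : trivIset P ->
  #|[set S in P | distinguishes S x y]| <= #|distinctive x y|.
Proof.
move=> tiP.
pose h S := odflt x [pick z in S :&: distinctive x y].
have hP S : distinguishes S x y -> h S \in S :&: distinctive x y.
  move=> /distinguishesP[z zS zD]; rewrite /h; case: pickP => //= /(_ z).
  by rewrite in_setI zS zD.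
have h_inj : {in [set S in P | distinguishes S x y] &, injective h}.
  move=> S T; rewrite !inE => /andP[PS /hP]; rewrite in_setI => /andP[hS _].
  move=> /andP[PT /hP]; rewrite in_setI => /andP[hT _] eq_h.
  apply/eqP; apply: contraT => neST.
  have /pred0P/(_ (h S)) := trivIsetP tiP _ _ PS PT neST.
  by rewrite /= hS eq_h hT.
rewrite -(card_in_imset h_inj); apply/subset_leq_card/subsetP => z /imsetP[S].
by rewrite inE => /andP[_ /hP] + ->; rewrite in_setI => /andP[].
Qed.

Lemma card_distinguishing_singletons x y :
  #|[set S in [set [set z] | z : G] | distinguishes S x y]|
    = #|distinctive x y|.
Proof.
rewrite -(card_imset (distinctive x y) (@set1_inj G)); apply: eq_card => S.
rewrite inE; apply/andP/imsetP => [[/imsetP[z _ ->] dz]|[z zD ->]].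
  exists z => //; move: dz.
  by rewrite inE /distinguishes !setdist1 dist_sym [dist y z]dist_sym.
split; first exact: imset_f.
by rewrite /distinguishes !setdist1 dist_sym [dist y z]dist_sym; rewrite inE in zD.
Qed.

Lemma singletons_partition : partition [set [set z] | z : G] [set: G].
Proof.
apply/and3P; split.
- apply/eqP/setP => z; rewrite inE; apply/bigcupP; exists [set z].
    exact: imset_f.
  exact: set11.
- apply/trivIsetP => _ _ /imsetP[y _ ->] /imsetP[z _ ->] neyz.
  by rewrite disjoints1 inE; apply: contra neyz => /eqP ->.
apply/negP => /imsetP[z _ /setP/(_ z)].
by rewrite !inE eqxx.
Qed.

Lemma partition_generator_singletons k : k <= frakd G ->
  partition_generator k [set [set z] | z : G].
Proof.
move=> le_k; split; first exact: singletons_partition.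
move=> x y nexy; rewrite card_distinguishing_singletons.
exact: leq_trans le_k (@bigmin_le _ _ _ _ (x, y) nexy).
Qed.

Lemma partition_generator_le k P : 2 <= #|G| ->
  partition_generator k P -> k <= frakd G.
Proof.
move=> G2 [/and3P[_ tiP _] genP].
have le_k x y : x != y -> k <= #|distinctive x y|.
  by move=> nexy; apply: leq_trans (genP x y nexy) (card_distinguishing _ _ tiP).
apply: le_bigmin => [|[x y]]; last exact: le_k.
(* The default [#|G|] of the minimum must also be at least [k]; any pair of different vertices shows
   this. *)
case/card_gt1P: G2 => x [y [_ _ nexy]].
exact: leq_trans (le_k x y nexy) (max_card _).
Qed.

(** The vertex [x] itself lies in [distinctive x y], since its distance to [x] is 0 and its distance
    to [y] is not. *)
Lemma frakd_gt0 : 0 < #|G| -> 0 < frakd G.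
Proof.
move=> G_gt0; apply: le_bigmin => // -[x y] /= nexy.
apply/card_gt0P; exists x.
by rewrite inE distxx eq_sym dist_eq0.
Qed.

(** Descent on the cardinality: either a strictly smaller generator exists, or [P] is already a
    basis. The predicate [better] is boolean so that this alternative can be decided by search. *)
Lemma partition_basis_exists k P : partition_generator k P ->
  exists Q : {set {set G}}, partition_basis k Q.
Proof.
have [m] := ubnP #|P|; elim: m P => // m IHm P; rewrite ltnS => leP genP.
pose better (Q : {set {set G}}) := [&& partition Q [set: G],
  [forall x, forall y, (x != y) ==>
     (k <= #|[set S in Q | distinguishes S x y]|)] & #|Q| < #|P|].
case: (pickP better) => [Q /and3P[parQ /'forall_'forall_implyP genQ ltQ]|noQ].
  by apply: (IHm Q) => //; exact: leq_trans ltQ leP.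
exists P; split=> // Q [parQ genQ]; rewrite leqNgt; apply/negP => ltQ.
case/negP: (noQ Q); rewrite /better parQ ltQ andbT /=.
by apply/'forall_'forall_implyP.
Qed.

Lemma partition_dimensional_frakd : 2 <= #|G| ->
  partition_dimensional G (frakd G).
Proof.
move=> G2; split; first by apply: frakd_gt0; exact: ltnW.
  exact: partition_basis_exists (partition_generator_singletons (leqnn _)).
by move=> l _ [P [genP _]]; exact: partition_generator_le genP.
Qed.

End Distance.

(** * Rules for total correctness with a time budget *)

Section Runs.
Variable w : nat.
Implicit Types (p : prog) (s : state) (e : expr) (P Q : state -> Prop).

Definition runs p s T Q := exists t s', [/\ exec w p s t s', t <= T & Q s'].

Lemma eval_const s c : c < w -> eval w s (Const c) = Some c.
Proof. by rewrite /= /word => ->. Qed.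

Lemma eval_reg s r a : regs s r = a -> a < w -> eval w s (Reg r) = Some a.
Proof. by rewrite /= /word => -> ->. Qed.

Lemma eval_read s e a v : eval w s e = Some a -> cells s a = v -> v < w ->
  eval w s (Read e) = Some v.
Proof. by rewrite /= /word => -> /= -> ->. Qed.

Lemma eval_bin s o e1 e2 a b v :
  eval w s e1 = Some a -> eval w s e2 = Some b -> binop_sem o a b = v ->
  v < w -> eval w s (Bin o e1 e2) = Some v.
Proof. by rewrite /= /word => -> /= -> /= -> ->. Qed.

Lemma eval_add s e1 e2 a b : eval w s e1 = Some a -> eval w s e2 = Some b ->
  a + b < w -> eval w s (Bin OpAdd e1 e2) = Some (a + b : nat).
Proof. by move=> ev1 ev2; apply: (eval_bin ev1 ev2). Qed.

Lemma eval_sub s e1 e2 a b : eval w s e1 = Some a -> eval w s e2 = Some b ->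
  a - b < w -> eval w s (Bin OpSub e1 e2) = Some (a - b : nat).
Proof. by move=> ev1 ev2; apply: (eval_bin ev1 ev2). Qed.

Lemma eval_mul s e1 e2 a b : eval w s e1 = Some a -> eval w s e2 = Some b ->
  a * b < w -> eval w s (Bin OpMul e1 e2) = Some (a * b : nat).
Proof. by move=> ev1 ev2; apply: (eval_bin ev1 ev2). Qed.

Lemma eval_eq s e1 e2 a b : eval w s e1 = Some a -> eval w s e2 = Some b ->
  (a == b) < w -> eval w s (Bin OpEq e1 e2) = Some ((a == b) : nat).
Proof. by move=> ev1 ev2; apply: (eval_bin ev1 ev2). Qed.

Lemma runs_weaken p s T T' Q Q' : T <= T' -> (forall s', Q s' -> Q' s') ->
  runs p s T Q -> runs p s T' Q'.
Proof.
move=> leT QQ' [t [s' [ex le_t Qs']]]; exists t, s'.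
by split=> //; [exact: leq_trans leT | exact: QQ'].
Qed.

Lemma runs_assign r e s v T Q : cost e < T -> eval w s e = Some v ->
  Q (set_reg s r v) -> runs (Assign r e) s T Q.
Proof. by move=> ltT ev Qs; do 2!eexists; split; [exact: exec_assign ev| |]. Qed.

Lemma runs_write e1 e2 s a v T Q : cost e1 + cost e2 < T ->
  eval w s e1 = Some a -> eval w s e2 = Some v -> Q (set_mem s a v) ->
  runs (Write e1 e2) s T Q.
Proof.
by move=> ltT ev1 ev2 Qs; do 2!eexists; split; [exact: exec_write ev1 ev2| |].
Qed.

Lemma runs_seq p1 p2 s T1 T2 Q1 Q : runs p1 s T1 Q1 ->
  (forall s', Q1 s' -> runs p2 s' T2 Q) -> runs (Seq p1 p2) s (T1 + T2) Q.
Proof.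
move=> [t1 [s1 [ex1 le1 /[swap] run2]]] /run2[t2 [s2 [ex2 le2 Qs]]].
by exists (t1 + t2), s2; split; [exact: exec_seq ex1 ex2 | exact: leq_add |].
Qed.

(** Register 0 holds the order of the graph during all loops and serves as their common bound. *)
Definition For r p :=
  Seq (Assign r (Const 0))
    (While (Bin OpLt (Reg r) (Reg 0))
       (Seq p (Assign r (Bin OpAdd (Reg r) (Const 1))))).

Definition for_inv n (I : nat -> state -> Prop) r i s :=
  [/\ I i s, regs s r = i & regs s 0 = n].

(** Each iteration costs the body plus 4 for the test and 4 for the increment; the initialisation
    (2) and the last test (4) add 6, which is absorbed by [14 * n] because [n] is positive. The
    invariant must survive any change of the counter. *)
Lemma runs_for n r p s T (I : nat -> state -> Prop) :
  0 < n < w -> r != 0 ->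
  (forall i v s1, I i s1 -> I i (set_reg s1 r v)) ->
  regs s 0 = n -> I 0 s ->
  (forall i s1, i < n -> for_inv n I r i s1 ->
     runs p s1 T (fun s2 => [/\ I i.+1 s2, regs s2 r = i & regs s2 0 = n])) ->
  runs (For r p) s (n * (T + 14)) (fun s1 => I n s1 /\ regs s1 0 = n).
Proof.
move=> /andP[n_gt0 n_w] r0 Ireg s0 I0 body.
have set_reg_r s1 v : regs (set_reg s1 r v) r = v by rewrite /= /upd eqxx.
have set_reg_0 s1 v : regs (set_reg s1 r v) 0 = regs s1 0.
  by rewrite /= /upd eq_sym (negPf r0).
have w1 : 1 < w by exact: leq_ltn_trans n_gt0 n_w.
(* Generalisation for the induction: [m] iterations remain when the counter is [i]. *)
suff loop : forall m s1 i, i + m = n -> for_inv n I r i s1 ->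
    runs (While (Bin OpLt (Reg r) (Reg 0))
       (Seq p (Assign r (Bin OpAdd (Reg r) (Const 1))))) s1
       (m * (T + 8) + 4) (fun s1 => I n s1 /\ regs s1 0 = n).
  apply: (@runs_weaken _ _ (2 + (n * (T + 8) + 4)) _ _ _ _ (fun _ x => x)); first by nia.
  apply: (@runs_seq _ _ _ 2 _ (for_inv n I r 0)) => [|s1 inv]; last exact: (loop n s1 0).
  apply: runs_assign; [by []|by apply: eval_const; lia|].
  by split; rewrite ?set_reg_r ?set_reg_0 //; apply: Ireg.
elim=> [|m IHm] s1 i im [Ii s1r s10].
  do 2!eexists; split; [apply: exec_while_end | by [] |].
    by apply: eval_bin; [apply: eval_reg s1r _ | apply: eval_reg s10 _ | rewrite /=; lia | lia]; lia.
  by split => //; move: im; rewrite addn0 => <-.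
have i_n : i < n by lia.
have [t1 [s2 [ex1 le1 [Ii2 s2r s20]]]] := body i s1 i_n (And3 Ii s1r s10).
have [t2 [s3 [ex2 le2 Q3]]] :
  runs (While (Bin OpLt (Reg r) (Reg 0))
       (Seq p (Assign r (Bin OpAdd (Reg r) (Const 1))))) (set_reg s2 r i.+1)
       (m * (T + 8) + 4) (fun s1 => I n s1 /\ regs s1 0 = n).
  apply: (IHm _ i.+1); first by lia.
  by split; rewrite ?set_reg_r ?set_reg_0 //; apply: Ireg.
exists (4 + ((t1 + 4) + t2)), s3; split=> //; last by lia.
apply: (@exec_while_loop _ _ 1); [| by [] | | exact: ex2].
  by apply: eval_bin; [apply: eval_reg s1r _ | apply: eval_reg s10 _ | rewrite /=; lia | lia]; lia.
apply: exec_seq ex1 _; apply: exec_assign.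
by apply: eval_bin; [apply: eval_reg s2r _ | apply: eval_const | rewrite /=; lia | lia]; lia.
Qed.

End Runs.

(** * The Floyd-Warshall invariant *)

Section FloydWarshall.
Variables (G : sgraph) (f : G -> 'I_#|G|).
Hypothesis f_inj : injective f.
Implicit Types (D : G -> G -> nat) (P Q : G -> G -> bool) (x y z : G).

(** Only the inner vertices [q] of the path are restricted to numbers below [k]; the endpoints are
    arbitrary, and the path has [(size q).+1] edges. *)
Definition short k D x y := forall q, path (@adj G) x (rcons q y) -> uniq q ->
  all (fun z => f z < k) q -> D x y <= (size q).+1.

(** [P] marks the pairs already relaxed in the round with pivot number [k]. Read as 0 or 1, [P x y]
    admits the pivot as an inner vertex exactly for these pairs. The upper bound [#|G|] keeps the
    entries within the word size. *)
Definition fw_inv k P D :=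
  forall x y, [/\ dist x y <= D x y, D x y <= #|G|, D x x = 0
                & short (k + P x y) D x y].

Lemma short_le k l D x y : k <= l -> short l D x y -> short k D x y.
Proof.
move=> le_kl sh q xq uq /allP q_k; apply: sh => //.
by apply/allP => z /q_k/leq_trans; apply.
Qed.

Lemma fw_inv_ext k P Q D D' : D =2 D' -> (forall x y, Q x y -> P x y) ->
  fw_inv k P D -> fw_inv k Q D'.
Proof.
move=> eqD QP inv x y; have [h1 h2 h3 h4] := inv x y; split; rewrite -?eqD //.
apply: (@short_le _ (k + P x y)).
  by rewrite leq_add2l; have := QP x y; case: (Q x y) => // ->.
by move=> q xq uq aq; rewrite -eqD; exact: h4.
Qed.

Lemma fw_inv_next k P D : (forall x y, P x y) -> fw_inv k P D ->
  fw_inv k.+1 (fun _ _ => false) D.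
Proof.
by move=> allP inv x y; have [? ? ? +] := inv x y; rewrite allP addn1 addn0.
Qed.

Lemma fw_inv_dist P D : fw_inv #|G| P D -> D =2 @dist G.
Proof.
move=> inv x y; have [ge_dist le_n Dxx sh] := inv x y.
apply/eqP; rewrite eqn_leq ge_dist andbT.
case: (dist_attained x y) => [-> //|[p [+ + + <-]]].
case: (lastP p) => [_ _ /= <-|q z]; first by rewrite Dxx.
rewrite last_rcons size_rcons cons_uniq rcons_uniq => xq /and3P[_ _ uq] zy.
rewrite zy in xq; apply: sh => //; apply/allP => v _.
exact: leq_trans (ltn_ord _) (leq_addr _ _).
Qed.

Definition update D x y v x' y' := if (x' == x) && (y' == y) then v else D x' y'.

(* The row and the column of z may already have been relaxed when they are read,
   which is harmless since relaxing only decreases the entries. *)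
Lemma fw_inv_relax P D x y z : fw_inv (f z) P D ->
  fw_inv (f z) (fun x' y' => P x' y' || (x' == x) && (y' == y))
    (update D x y (minn (D x y) (D x z + D z y))).
Proof.
move=> inv x' y'; have [ge_dist le_n Dxx sh] := inv x' y'.
have upd_xx : update D x y (minn (D x y) (D x z + D z y)) x' x' = 0.
  by rewrite /update; case: ifP => // /andP[/eqP <- /eqP <-]; rewrite Dxx min0n.
split=> //.
- rewrite /update; case: ifP => // /andP[/eqP <- /eqP <-].
  rewrite leq_min ge_dist (leq_trans (dist_triangle x' z y')) //.
  have [? _ _ _] := inv x' z; have [? _ _ _] := inv z y'.
  exact: leq_add.
- rewrite /update; case: ifP => // /andP[/eqP <- /eqP <-].
  exact: leq_trans (geq_minl _ _) le_n.
rewrite /short /update.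
case: ifP => [/andP[/eqP <- /eqP <-]|_]; last by rewrite orbF.
rewrite orbT addn1 => q xq uq /allP q_z; rewrite geq_min.
(* If the path avoids the pivot [z], all its inner numbers are below [f z] and the old entry
   suffices. Otherwise it is cut at [z]; as [q] has no repetition, both halves have inner numbers
   below [f z]. *)
have [zq|zNq] := boolP (z \in q); last first.
  apply/orP; left; apply: sh => //; apply/allP => v vq.
  apply: leq_trans (leq_addr _ _).
  rewrite ltn_neqAle -ltnS q_z // andbT; apply: contraNneq zNq.
  by move/val_inj/f_inj => <-.
apply/orP; right; case/splitPr: zq xq uq q_z => q1 q2.
rewrite -cat_rcons rcons_cat cat_path last_rcons cat_uniq rcons_uniq.
move=> /andP[xq1 zq2] /and3P[/andP[zNq1 uq1] /hasPn q1q2 uq2] q_z.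
have lt_z v : v \in q1 ++ q2 -> v != z -> f v < f z.
  rewrite mem_cat => vq v_z; rewrite ltn_neqAle -ltnS q_z.
    by rewrite andbT; apply: contraNneq v_z => /val_inj/f_inj ->.
  by rewrite mem_cat mem_rcons inE -orbA vq orbT.
have lt1 : all (fun v => f v < f z) q1.
  apply/allP => v vq; apply: lt_z; first by rewrite mem_cat vq.
  by apply: contraNneq zNq1 => <-.
have lt2 : all (fun v => f v < f z) q2.
  apply/allP => v vq; apply: lt_z; first by rewrite mem_cat vq orbT.
  by apply: contraTneq vq => ->; apply/negP => /q1q2; rewrite mem_rcons inE eqxx.
have [_ _ _ sh1] := inv x' z; have [_ _ _ sh2] := inv z y'.
have := leq_add (short_le (leq_addr _ _) sh1 xq1 uq1 lt1)
                (short_le (leq_addr _ _) sh2 zq2 uq2 lt2).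
by rewrite size_cat size_rcons addnS addSnnS.
Qed.

(* No distance exceeds the order of the graph, which thus stands for infinity. *)
Definition weight x y := if x == y then 0 else if adj x y then 1 else #|G|.

(** No number is below 0, so [short] concerns only paths without inner vertices, that is, single
    edges. *)
Lemma fw_inv_weight : fw_inv 0 (fun _ _ => false) weight.
Proof.
move=> x y; have G_gt0 : 0 < #|G| by apply/card_gt0P; exists x.
rewrite /weight eqxx; split=> //.
- case: eqP => [->|_]; first by rewrite distxx.
  case: ifP => [xy|_]; last exact: dist_le_order.
  by apply: (@dist_le_path _ _ _ [:: y]); rewrite //= xy.
- by case: eqP => // _; case: ifP.
move=> [|z q] //=; rewrite andbT => xy _ _.
by rewrite /weight xy; case: eqP.
Qed.

(** * Matrix layout, word bounds and loops over pairs of vertices *)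

Local Notation n := #|G|.
Local Notation w := (#|G| ^ 3).

Definition addr a b := Bin OpAdd (Bin OpMul (Reg a) (Reg 0)) (Reg b).
Definition entry a b := Read (addr a b).

Definition cell s x y := cells s (f x * n + f y).

(** Division with remainder by [n] recovers row and column from the address, so different pairs
    occupy different cells. *)
Lemma cell_set_mem s x y v :
  cell (set_mem s (f x * n + f y) v) =2 update (cell s) x y v.
Proof.
move=> x' y'; rewrite /cell /update /= /upd; congr (if _ then _ else _).
apply/eqP/andP => [eq_a|[/eqP -> /eqP ->] //].
have n_gt0 : 0 < n by apply/card_gt0P; exists x.
have := congr1 (modn^~ n) eq_a; rewrite /= !modnMDl !modn_small //.
have := congr1 (divn^~ n) eq_a; rewrite /= !divnMDl // !divn_small // !addn0.
by move=> /val_inj/f_inj -> /val_inj/f_inj ->.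
Qed.

(** An injection between sets of equal size is bijective; this turns loop counters into vertices. *)
Lemma num_surj i : i < n -> exists x, f x = i :> nat.
Proof.
move=> i_n; have [g _ gK] := inj_card_bij f_inj (eq_leq (card_ord n)).
by exists (g (Ordinal i_n)); rewrite gK.
Qed.

Hypothesis G2 : 2 <= n.

(** Since [n >= 2] gives [n + 1 < n * n], also [n * n + n < n ^ 3]. Addresses and sums of two
    entries stay within this bound. *)
Lemma word_small v : v <= n * n + n -> v < w.
Proof.
by move=> le_v; rewrite !expnS expn0 muln1; have := G2; move: le_v; nia.
Qed.

Lemma addr_small x y : f x * n + f y < n * n.
Proof. by have := ltn_ord (f x); have := ltn_ord (f y); nia. Qed.

Lemma eval_addr s a b x y : regs s 0 = n -> regs s a = f x -> regs s b = f y ->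
  eval w s (addr a b) = Some (f x * n + f y).
Proof.
move=> s0 sa sb; have := addr_small x y; have := ltn_ord (f x); have := ltn_ord (f y).
move=> hy hx hxy.
have fxn : f x * n < w by apply: word_small; lia.
have xyn : f x * n + f y < w by apply: word_small; lia.
apply: eval_add _ _ xyn; last by apply: eval_reg sb _; apply: word_small; lia.
apply: eval_mul _ _ fxn; first by apply: eval_reg sa _; apply: word_small; lia.
by apply: eval_reg s0 _; apply: word_small; lia.
Qed.

Lemma eval_entry s a b x y : cell s x y <= n ->
  regs s 0 = n -> regs s a = f x -> regs s b = f y ->
  eval w s (entry a b) = Some (cell s x y).
Proof.
move=> le_n s0 sa sb; apply: eval_read (eval_addr s0 sa sb) (erefl _) _.
by apply: word_small; exact: leq_trans le_n (leq_addl _ _).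
Qed.

Lemma n_small : 0 < n < w.
Proof. by rewrite word_small ?leq_addl // andbT; exact: ltnW. Qed.

Lemma bit_small v : v <= 1 -> v < w.
Proof.
move=> v1; apply: word_small.
exact: leq_trans v1 (leq_trans (ltnW G2) (leq_addl _ _)).
Qed.

(** The lexicographic order in which a double loop treats the pairs. *)
Definition before i j x y := (f x < i) || (f x == i :> nat) && (f y < j).

Lemma before0 i x y : before i 0 x y = (f x < i).
Proof. by rewrite /before andbF orbF. Qed.

Lemma before_full i x y : before i n x y = (f x < i.+1).
Proof. by rewrite /before ltn_ord andbT ltnS [f x <= i]leq_eqVlt orbC. Qed.

Lemma beforeS x0 y0 x y : before (f x0) (f y0).+1 x y =
  before (f x0) (f y0) x y || (x == x0) && (y == y0).
Proof.
have eqf u v : (f u == f v :> nat) = (u == v).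
  by apply/eqP/eqP => [/val_inj/f_inj|->].
rewrite /before !eqf ltnS [f y <= _]leq_eqVlt eqf; case: (x == x0); rewrite ?andbF ?orbF //=.
by rewrite orbAC orbA.
Qed.

(* The invariant I is indexed by the set of pairs already treated. *)
Lemma runs_for2 r1 r2 p s T (I : (G -> G -> bool) -> state -> Prop) :
  r1 != 0 -> r2 != 0 -> r1 != r2 ->
  (forall P Q s1, P =2 Q -> I P s1 -> I Q s1) ->
  (forall P r v s1, r \in [:: r1; r2] -> I P s1 -> I P (set_reg s1 r v)) ->
  (forall x y P s1, regs s1 0 = n -> regs s1 r1 = f x -> regs s1 r2 = f y ->
     ~~ P x y -> I P s1 ->
     runs w p s1 T (fun s2 => [/\ regs s2 0 = n, regs s2 r1 = f x,
        regs s2 r2 = f y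
        & I (fun x' y' => P x' y' || (x' == x) && (y' == y)) s2])) ->
  regs s 0 = n -> I (fun _ _ => false) s ->
  runs w (For r1 (For r2 p)) s (n * (n * (T + 14) + 14))
    (fun s1 => I (fun _ _ => true) s1 /\ regs s1 0 = n).
Proof.
move=> r1_0 r2_0 r12 Iext Ireg body s0 I0.
pose I1 i s1 := I (before i 0) s1.
apply: (@runs_weaken w _ _ _ _ (fun s1 => I1 n s1 /\ regs s1 0 = n) _ (leqnn _)).
  by move=> s1 [I1n ?]; split=> //; apply: Iext I1n => x y; rewrite before0 ltn_ord.
apply: runs_for => //; first exact: n_small.
- by move=> i v s1; apply: Ireg; rewrite inE eqxx.
- by apply: Iext I0 => x y; rewrite before0.
move=> i s1 i_n [I1i s1r s10]; have [x fx] := num_surj i_n.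
(* The inner invariant also records the outer counter, which the outer loop needs back unchanged. *)
pose I2 j s2 := I (before i j) s2 /\ regs s2 r1 = i.
apply: (@runs_weaken w _ _ _ _ (fun s2 => I2 n s2 /\ regs s2 0 = n) _ (leqnn _)).
  move=> s2 [[I2n ?] ?]; split=> //; apply: Iext I2n => u v.
  by rewrite before_full before0.
apply: runs_for => //; first exact: n_small.
- move=> j v s2 [? ?]; split; first by apply: Ireg => //; rewrite !inE eqxx orbT.
  by rewrite /= /upd (negPf r12).
move=> j s2 j_n [[I2j s2r1] s2r2 s20]; have [y fy] := num_surj j_n.
move: s2r1 s2r2 I2j; rewrite -fx -fy => s2r1 s2r2 I2j.
(* The current pair is still untreated, so a body working in place may rely on the original content
   of its cell. *)
have notP : ~~ before (f x) (f y) x y by rewrite /before !ltnn andbF.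
apply: runs_weaken (leqnn _) _ (body x y _ s2 s20 s2r1 s2r2 notP I2j).
move=> s3 [s30 s3r1 s3r2 I3]; split=> //; split; last by rewrite s3r1.
by apply: Iext I3 => u v; rewrite -fx beforeS.
Qed.

(* With truncated subtraction, a - (a - b) is the minimum of a and b. *)
Lemma eval_min s e1 e2 a b : a <= n -> eval w s e1 = Some a ->
  eval w s e2 = Some b ->
  eval w s (Bin OpSub e1 (Bin OpSub e1 e2)) = Some (minn a b).
Proof.
move=> a_n ev1 ev2; rewrite minnE.
have small m : m <= a -> m < w.
  move=> m_a; apply: word_small; exact: leq_trans m_a (leq_trans a_n (leq_addl _ _)).
apply: (eval_sub ev1 (eval_sub ev1 ev2 _)); exact: small (leq_subr _ _).
Qed.

(** * The weight matrix and the Floyd-Warshall program *)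

Definition neg e := Bin OpSub (Const 1) e.

Lemma eval_neg s e (b : bool) : eval w s e = Some (b : nat) ->
  eval w s (neg e) = Some (~~ b : nat).
Proof.
move=> ev; have -> : (~~ b : nat) = 1 - b by case: b {ev}.
by apply: eval_sub ev _; [apply: eval_const|]; rewrite bit_small ?leq_subr.
Qed.

Lemma eval_eq_num s a b x y : regs s a = f x -> regs s b = f y ->
  eval w s (Bin OpEq (Reg a) (Reg b)) = Some (x == y : nat).
Proof.
move=> sa sb; have fs z : f z < w.
  by apply: ltn_trans (ltn_ord _) _; case/andP: n_small.
have -> : (x == y) = (f x == f y :> nat).
  by apply/eqP/eqP => [->|/val_inj/f_inj].
apply: eval_eq; [exact: eval_reg sa (fs _) | exact: eval_reg sb (fs _)|].
exact: bit_small (leq_b1 _).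
Qed.

(** Arithmetic replaces branching: with adjacency bit [a], the value [a + (1 - a) * n] is 1 on edges
    and [n] on non-edges, and the first factor clears the diagonal. *)
Definition weight_prog :=
  For 1 (For 2 (Write (addr 1 2)
    (Bin OpMul (neg (Bin OpEq (Reg 1) (Reg 2)))
       (Bin OpAdd (entry 1 2) (Bin OpMul (neg (entry 1 2)) (Reg 0)))))).

Lemma runs_weight_prog s : regs s 0 = n ->
  (forall x y, cell s x y = adj x y) ->
  runs w weight_prog s (n * (n * (100 + 14) + 14))
    (fun s1 => cell s1 =2 weight /\ regs s1 0 = n).
Proof.
move=> s0 s_adj.
pose I (P : G -> G -> bool) s1 :=
  forall x y, cell s1 x y = if P x y then weight x y else adj x y.
apply: (runs_weaken (leqnn _) _ (@runs_for2 1 2 _ s 100 I _ _ _ _ _ _ s0 _)) => //.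
  by move=> P Q s1 PQ IP x y; rewrite -PQ.
move=> x y P s1 s10 s11 s12 notPxy IP.
have s1_xy : cell s1 x y = adj x y by rewrite IP (negPf notPxy).
have s1_n : cell s1 x y <= n.
  by rewrite s1_xy (leq_trans (leq_b1 _)) // ltnW.
have ev := eval_entry s1_n s10 s11 s12; rewrite s1_xy in ev.
have small v : v <= n + n -> v < w.
  move=> v_n; apply: word_small; apply: leq_trans v_n _.
  by rewrite leq_add2r leq_pmulr // ltnW.
have w_n : (~~ adj x y) * n <= n by case: adj; rewrite ?mul0n ?mul1n.
have w_a : adj x y + (~~ adj x y) * n <= n.
  by case: adj; rewrite ?mul0n ?mul1n //= ltnW.
have w_w : (~~ (x == y)) * (adj x y + (~~ adj x y) * n) = weight x y.
  by rewrite /weight; case: eqP; case: adj; rewrite ?mul1n.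
have ev0 : eval w s1 (Reg 0) = Some n by apply: eval_reg s10 _; case/andP: n_small.
apply: (@runs_write _ _ _ _ (f x * n + f y) (weight x y)) => //.
- exact: eval_addr.
- rewrite -w_w; apply: eval_mul.
  + by apply: eval_neg; exact: eval_eq_num.
  + apply: (eval_add ev _ _); last by apply: small; lia.
    by apply: (eval_mul (eval_neg ev) ev0); apply: small; lia.
  + by apply: small; case: eqP; rewrite ?mul0n ?mul1n //; lia.
split=> // x' y'; rewrite cell_set_mem /update IP.
by case: ifP => [/andP[/eqP -> /eqP ->]|_]; rewrite ?orbT ?orbF.
Qed.

(** Register 1 numbers the pivot, registers 2 and 3 the row and the column. *)
Definition fw_prog :=
  For 1 (For 2 (For 3 (Write (addr 2 3)
    (Bin OpSub (entry 2 3) (Bin OpSub (entry 2 3)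
       (Bin OpAdd (entry 2 1) (entry 1 3))))))).

Lemma runs_fw_prog s : regs s 0 = n -> cell s =2 weight ->
  runs w fw_prog s (n * (n * (n * (100 + 14) + 14) + 14))
    (fun s1 => cell s1 =2 @dist G /\ regs s1 0 = n).
Proof.
move=> s0 s_weight.
(* Between rounds, all pivots numbered below [k] are done and no pair is marked. *)
pose J k s1 := fw_inv k (fun _ _ => false) (cell s1).
apply: (@runs_weaken w _ _ _ _ (fun s1 => J n s1 /\ regs s1 0 = n) _ (leqnn _)).
  by move=> s1 [/fw_inv_dist].
apply: runs_for => //; first exact: n_small.
  apply: fw_inv_ext fw_inv_weight => // x y; by rewrite s_weight.
move=> _ s1 /num_surj[z <-] [Jk s11 s10].
pose I P s2 := fw_inv (f z) P (cell s2) /\ regs s2 1 = f z.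
apply: (runs_weaken (leqnn _) _ (@runs_for2 2 3 _ s1 100 I _ _ _ _ _ _ s10 _)) => //.
- by move=> s2 [[inv ?] ?]; split=> //; exact: (fw_inv_next _ inv).
- move=> P Q s2 PQ [inv ?]; split=> //; apply: fw_inv_ext inv => // x y.
  by rewrite PQ.
- move=> P r v s2; rewrite !inE => r23 [? s21]; split=> //.
  by case/orP: r23 => /eqP ->.
move=> x y P s2 s20 s22 s23 _ [inv s21].
have cell_n u v : cell s2 u v <= n by have [] := inv u v.
apply: (@runs_write _ _ _ _ (f x * n + f y)) => //.
- exact: eval_addr.
- apply: eval_min (cell_n x y) _ _; first exact: eval_entry.
  apply: eval_add; [exact: (eval_entry (cell_n x z)) | exact: (eval_entry (cell_n z y))|].
  apply: word_small; apply: leq_trans (leq_add (cell_n _ _) (cell_n _ _)) _.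
  by rewrite leq_add2r leq_pmulr // ltnW.
split=> //; split=> //; apply: fw_inv_ext (fw_inv_relax x y inv) => // u v.
by rewrite cell_set_mem.
Qed.

(** * Counting distinctive vertices and minimising over pairs *)

Definition best P m :=
  [/\ frakd G <= m, m <= n
    & forall x y, P x y -> x != y -> m <= #|distinctive x y|].

(** Once every pair is treated, [m] is below all terms of the minimum and below its default, hence
    equal to it. *)
Lemma best_frakd m : best (fun _ _ => true) m -> m = frakd G.
Proof.
case=> ge_m m_n le_m; apply/eqP; rewrite eqn_leq ge_m andbT.
by apply: le_bigmin => // -[x y]; exact: le_m.
Qed.

(** On the diagonal the added [n] makes the candidate at least [n >= m], so the pair [x = y] is
    skipped without a branch. *)
Lemma best_min P m x y : best P m ->
  best (fun x' y' => P x' y' || (x' == x) && (y' == y))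
    (minn m (#|distinctive x y| + (x == y) * n)).
Proof.
move=> [ge_m m_n le_m]; split.
- rewrite leq_min ge_m; case: eqP => [_|/eqP nexy].
    by rewrite mul1n (leq_trans ge_m) // (leq_trans m_n) // leq_addl.
  by rewrite mul0n addn0; exact: (@bigmin_le _ _ _ _ (x, y) nexy).
- exact: leq_trans (geq_minl _ _) m_n.
move=> x' y' /orP[Pxy|/andP[/eqP -> /eqP ->]] nexy.
  exact: leq_trans (geq_minl _ _) (le_m _ _ Pxy nexy).
by rewrite (negPf nexy) mul0n addn0 geq_minr.
Qed.

Definition count_prog :=
  For 3 (Assign 4 (Bin OpAdd (Reg 4) (neg (Bin OpEq (entry 3 1) (entry 3 2))))).

Lemma runs_count_prog s x y :
  regs s 0 = n -> regs s 1 = f x -> regs s 2 = f y -> regs s 4 = 0 ->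
  cell s =2 @dist G ->
  runs w count_prog s (n * (100 + 14))
    (fun s1 => [/\ cell s1 =2 @dist G, regs s1 1 = f x, regs s1 2 = f y,
       regs s1 5 = regs s 5 & regs s1 4 = #|distinctive x y|] /\ regs s1 0 = n).
Proof.
move=> s0 s1 s2 s4 sD.
(* [C k] is the content of register 4 after the first [k] vertices; passing [z] adds 1 exactly when
   [z] is distinctive. *)
pose C k := #|[set z in distinctive x y | f z < k]|.
have C0 : C 0 = 0 by apply: eq_card0 => z; rewrite !inE andbF.
have Cn : C n = #|distinctive x y|.
  by apply: eq_card => z; rewrite inE ltn_ord andbT.
have CS z : C (f z).+1 = C (f z) + ~~ (dist z x == dist z y).
  rewrite /C (cardsD1 z) !inE ltnSn andbT addnC; congr (_ + _).
  apply: eq_card => u; rewrite !inE ltnS ltn_neqAle andbCA; congr (_ && _).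
  by congr (~~ _ && _); apply/eqP/eqP => [->|/val_inj/f_inj].
pose I k t := [/\ cell t =2 @dist G, regs t 1 = f x, regs t 2 = f y,
  regs t 5 = regs s 5 & regs t 4 = C k].
rewrite -Cn; apply: (@runs_for w n 3 _ s 100 I) => //; first exact: n_small.
  by split=> //; rewrite C0.
move=> _ t /num_surj[z <-] [[tD t1 t2 t5 t4] t3 t0].
have C_n k : C k <= n by exact: max_card.
have small v : v <= n -> v < w by case/andP: n_small => _; move=> + ?; exact: leq_ltn_trans.
have ev u r : regs t r = f u -> eval w t (entry 3 r) = Some (dist z u).
  by move=> tr; rewrite -tD; apply: eval_entry => //; rewrite tD dist_le_order.
apply: (@runs_assign _ _ _ _ (C (f z).+1)) => //.
rewrite CS; apply: eval_add.
- by apply: eval_reg t4 _; apply: small.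
- apply: eval_neg; apply: (eval_eq (ev _ _ t1) (ev _ _ t2)).
  exact: bit_small (leq_b1 _).
by rewrite -CS small.
Qed.

Definition min_prog :=
  For 1 (For 2 (Seq (Assign 4 (Const 0)) (Seq count_prog
    (Assign 5 (Bin OpSub (Reg 5) (Bin OpSub (Reg 5) (Bin OpAdd (Reg 4)
       (Bin OpMul (Bin OpEq (Reg 1) (Reg 2)) (Reg 0))))))))).

Lemma runs_min_prog s : regs s 0 = n -> regs s 5 = n -> cell s =2 @dist G ->
  runs w min_prog s (n * (n * (100 + (n * (100 + 14) + 100) + 14) + 14))
    (fun s1 => regs s1 5 = frakd G).
Proof.
move=> s0 s5 sD.
pose I P s1 := cell s1 =2 @dist G /\ best P (regs s1 5).
apply: (runs_weaken (leqnn _) _ (@runs_for2 1 2 _ s _ I _ _ _ _ _ _ s0 _)) => //.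
- by move=> s1 [[_ /best_frakd]].
- by move=> P Q s1 PQ [? [? ? le_m]]; split=> //; split=> // x y; rewrite -PQ; exact: le_m.
- by move=> P r v s1; rewrite !inE => /orP[] /eqP ->.
- move=> x y P s1 s10 s11 s12 _ [s1D s1B].
  apply: (@runs_seq _ _ _ _ 100 _ (fun s2 => s2 = set_reg s1 4 0)).
    by apply: (@runs_assign _ _ _ _ 0) => //; apply: eval_const; exact: bit_small.
  move=> _ ->; apply: runs_seq; first exact: (@runs_count_prog (set_reg s1 4 0) x y).
  move=> s3 [[s3D s31 s32 s35 s34] s30].
  have {}s35 : regs s3 5 = regs s1 5 by [].
  have s3_n : regs s3 5 <= n by rewrite s35; case: s1B.
  have D_n : #|distinctive x y| <= n by exact: max_card.
  have small v : v <= n + n -> v < w.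
    move=> v_n; apply: word_small; apply: leq_trans v_n _.
    by rewrite leq_add2r leq_pmulr // ltnW.
  have e_n : (x == y) * n <= n by case: eqP; rewrite ?mul0n ?mul1n.
  apply: (@runs_assign _ _ _ _ (minn (regs s3 5) (#|distinctive x y| + (x == y) * n))) => //.
    apply: eval_min => //; first by apply: eval_reg => //; apply: small; lia.
    apply: eval_add; first by apply: eval_reg => //; apply: small; lia.
      apply: eval_mul; first exact: eval_eq_num.
        by apply: eval_reg => //; apply: small; lia.
      by apply: small; lia.
    by apply: small; lia.
  by split=> //; split=> //; rewrite /= s35; exact: best_min.
(* The running minimum starts at [n], the default value in [frakd]. *)
split=> //; rewrite s5; split=> //; exact: bigmin_le_default.
Qed.

End FloydWarshall.

(** * The complete program and its cubic running time *)

Definition frakd_prog :=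
  Seq weight_prog (Seq fw_prog
    (Seq (Assign 5 (Reg 0)) (Seq min_prog (Assign 0 (Reg 5))))).

Lemma frakd_computable :
  computable_in_time (fun G : sgraph => connected_graph G /\ 2 <= #|G|)
    frakd (fun n : nat => n ^ 3).
Proof.
(* Words are below [n ^ 3]. The budgets add up to a cubic polynomial with leading coefficient 228,
   114 from the relaxations and 114 from the counting; 2000 generously covers the lower terms. *)
exists frakd_prog, 3, 2000 => G [_ G2] f s f_inj [s0 _ s_adj _].
set n := #|G| in G2 *.
have n_w : n < n ^ 3 by have /andP[] := n_small G2.
have [t [s' [ex le_t res]]] : runs (n ^ 3) frakd_prog s
    (n * (n * (100 + 14) + 14) + (n * (n * (n * (100 + 14) + 14) + 14) +
      (100 + (n * (n * (100 + (n * (100 + 14) + 100) + 14) + 14) + 100))))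
    (fun s' => regs s' 0 = frakd G).
  apply: runs_seq; first exact: (runs_weight_prog f_inj G2 s0).
  move=> s1 [s1D s10].
  apply: runs_seq; first exact: (runs_fw_prog f_inj G2 s10 s1D).
  move=> s2 [s2D s20].
  apply: (@runs_seq _ _ _ _ _ _ (fun s3 => s3 = set_reg s2 5 n)).
    by apply: (@runs_assign _ _ _ _ n) => //; exact: eval_reg.
  move=> _ ->; apply: runs_seq.
    by apply: (@runs_min_prog G f f_inj G2 (set_reg s2 5 n)).
  move=> s4 s45; apply: (@runs_assign _ _ _ _ (frakd G)) => //.
  by apply: eval_reg s45 _; apply: leq_ltn_trans n_w; exact: bigmin_le_default.
exists t, s'; split=> //; apply: leq_trans le_t _.
by move: G2; rewrite !expnS expn0; clear; nia.
Qed.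

Theorem theorem3 :
  (forall G : sgraph, connected_graph G -> 2 <= #|G| ->
     partition_dimensional G (frakd G)) /\
  computable_in_time (fun G : sgraph => connected_graph G /\ 2 <= #|G|)
    frakd (fun n : nat => n ^ 3).
Proof.
split; last exact: frakd_computable.
by move=> G _; exact: partition_dimensional_frakd.
Qed.
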